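(* Let $\mathbf V$ be a monoid variety whose membership problem is decidable (given a finite monoid, decide whether it belongs to $\mathbf V$). Then there is an algorithm that, given a DFT $T$, decides whether the function defined by $T$ is definable by some $\mathbf V$-DFT.
   Context: A (real-time) deterministic finite state transducer (DFT) over $\Sigma$ is $T=(Q,q_0,F,\delta,i,t)$ with a partial transition function $\delta:Q\times\Sigma\to Q\times\Sigma^\ast$, final states $F$, initial output $i$ and terminal output $t:F\to\Sigma^\ast$; it maps $u$ to $i\,w\,t(q)$ if reading $u$ from $q_0$ reaches $q\in F$ while producing $w$. The underlying automaton forgets outputs. Its transition monoid is $\Sigma^\ast/\equiv$ where $u\equiv v$ iff for all states $p,q$ there is a run from $p$ to $q$ on $u$ iff there is one on $v$. A $\mathbf V$-DFT is a DFT whose transition monoid lies in $\mathbf V$. *)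

(* Defs.v *)
From mathcomp Require Import all_boot.
Set Implicit Arguments. Unset Strict Implicit. Unset Printing Implicit Defensive.

(* There is an algorithm is rendered as: there is a mu-recursive      *)
(* code; inputs are encoded as natural numbers through MathComp's       *)
(* canonical countType encoding [pickle] of concrete data.               *)

Inductive code : Type :=
  | cZero : code
  | cSucc : code
  | cProj : nat -> code
  | cComp : code -> seq code -> code
  | cPrim : code -> code -> code
  | cMu   : code -> code.

Inductive eval : code -> seq nat -> nat -> Prop :=
  | ev_zero args : eval cZero args 0
  | ev_succ x args : eval cSucc (x :: args) x.+1
  | ev_proj i args : i < size args -> eval (cProj i) args (nth 0 args i)
  | ev_comp f gs args ys z :
      evals gs args ys -> eval f ys z -> eval (cComp f gs) args z
  | ev_prim0 f g args y : eval f args y -> eval (cPrim f g) (0 :: args) y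
  | ev_primS f g n args r y :
      eval (cPrim f g) (n :: args) r -> eval g (n :: r :: args) y ->
      eval (cPrim f g) (n.+1 :: args) y
  | ev_mu f args n :
      eval f (n :: args) 0 ->
      (forall m, m < n -> exists r, r <> 0 /\ eval f (m :: args) r) ->
      eval (cMu f) args n
with evals : seq code -> seq nat -> seq nat -> Prop :=
  | evs_nil args : evals [::] args [::]
  | evs_cons g gs args y ys :
      eval g args y -> evals gs args ys -> evals (g :: gs) args (y :: ys).

Definition decides_on (X : Type) (enc : X -> nat) (P : X -> Prop) (c : code) :=
  forall x, (P x -> eval c [:: enc x] 1) /\ (~ P x -> eval c [:: enc x] 0).

Record fmon := FMon {
  fm_n : nat;
  fm_mul : 'I_fm_n -> 'I_fm_n -> 'I_fm_n;
  fm_one : 'I_fm_n;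
  fm_assoc : forall x y z, fm_mul x (fm_mul y z) = fm_mul (fm_mul x y) z;
  fm_unitl : forall x, fm_mul fm_one x = x;
  fm_unitr : forall x, fm_mul x fm_one = x }.

Definition fm_encode (M : fmon) : nat :=
  pickle (fm_n M, (val (fm_one M),
    [seq [seq val (fm_mul i j) | j <- enum 'I_(fm_n M)] | i <- enum 'I_(fm_n M)])).

Definition is_morph (M N : fmon) (h : 'I_(fm_n M) -> 'I_(fm_n N)) :=
  h (fm_one M) = fm_one N /\ forall x y, h (fm_mul x y) = fm_mul (h x) (h y).

Definition divides (M N : fmon) :=
  exists (S : 'I_(fm_n N) -> bool) (h : 'I_(fm_n N) -> 'I_(fm_n M)),
    [/\ S (fm_one N), (forall x y, S x -> S y -> S (fm_mul x y)),
        h (fm_one N) = fm_one M,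
        (forall x y, S x -> S y -> h (fm_mul x y) = fm_mul (h x) (h y)) &
        (forall m, exists x, S x /\ h x = m)].

Definition embeds2 (M N1 N2 : fmon) :=
  exists (h1 : 'I_(fm_n M) -> 'I_(fm_n N1)) (h2 : 'I_(fm_n M) -> 'I_(fm_n N2)),
    [/\ is_morph h1, is_morph h2 &
        forall x y, h1 x = h1 y -> h2 x = h2 y -> x = y].

(* A (pseudo)variety of finite monoids: nonempty, closed under division
   (hence under isomorphism, submonoids, quotients) and finite products. *)
Record monoid_variety (V : fmon -> Prop) : Prop := {
  mv_nonempty : exists M, V M;
  mv_div : forall M N, divides M N -> V N -> V M;
  mv_prod : forall M N1 N2, V N1 -> V N2 -> embeds2 M N1 N2 -> V M }.

Record dft (k : nat) := Dft {
  d_n : nat;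
  d_init : 'I_d_n;
  d_delta : 'I_d_n -> 'I_k -> option ('I_d_n * seq 'I_k);
  d_iout : seq 'I_k;
  d_term : 'I_d_n -> option (seq 'I_k) }.                    (* F and t : F -> Sigma^* *)

Arguments d_n {k} d.
Arguments d_init {k} d.
Arguments d_delta {k} d _ _.
Arguments d_iout {k} d.
Arguments d_term {k} d _.

Fixpoint drun k (T : dft k) (p : 'I_(d_n T)) (u : seq 'I_k)
  : option ('I_(d_n T) * seq 'I_k) :=
  match u with
  | [::] => Some (p, [::])
  | a :: u' =>
      match d_delta T p a with
      | None => None
      | Some (q, w) =>
          match @drun k T q u' with
          | None => None
          | Some (r, w') => Some (r, w ++ w')
          end
      end
  end.

Arguments drun {k} T p u.

Definition dfun k (T : dft k) (u : seq 'I_k) : option (seq 'I_k) :=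
  match drun T (d_init T) u with
  | Some (q, w) =>
      match d_term T q with
      | Some t => Some (d_iout T ++ w ++ t)
      | None => None
      end
  | None => None
  end.

Definition trans_equiv k (T : dft k) (u v : seq 'I_k) :=
  forall p q, (exists w, drun T p u = Some (q, w)) <-> (exists w, drun T p v = Some (q, w)).

Definition is_transition_monoid k (T : dft k) (M : fmon) :=
  exists phi : seq 'I_k -> 'I_(fm_n M),
    [/\ phi [::] = fm_one M,
        (forall u v, phi (u ++ v) = fm_mul (phi u) (phi v)),
        (forall m, exists u, phi u = m) &
        (forall u v, phi u = phi v <-> trans_equiv T u v)].

Definition V_dft (V : fmon -> Prop) k (T : dft k) :=
  exists M, V M /\ is_transition_monoid T M.

Definition V_definable (V : fmon -> Prop) k (T : dft k) :=
  exists T' : dft k, V_dft V T' /\ forall u, dfun T' u = dfun T u.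

Definition dft_encode k (T : dft k) : nat :=
  pickle (k, (d_n T, (val (d_init T),
    ([seq [seq omap (fun qw => (val qw.1, map val qw.2)) (d_delta T q a)
              | a <- enum 'I_k] | q <- enum 'I_(d_n T)],
     (map val (d_iout T),
      [seq omap (map val) (d_term T q) | q <- enum 'I_(d_n T)]))))).

(* Main.v *)
Require Import Defs.
From mathcomp Require Import all_boot.
From Stdlib Require Import Classical ClassicalEpsilon.
Set Implicit Arguments. Unset Strict Implicit. Unset Printing Implicit Defensive.

(* Let f be the function of T.  Two words x, y are similar ([Sim]) when, for all
   continuations w1 and w2, the quotients f(xw1)^-1 f(xw2) and f(yw1)^-1 f(yw2)
   in the free group agree and are defined simultaneously; u, v are congruent
   ([Cong]) when xu and xv are similar for all x.  The transition congruence of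
   every DFT computing f refines [Cong].  Conversely the right Cayley graph of
   the quotient by [Cong], with outputs lcp(x)^-1 lcp(xa), where lcp(x) is the
   longest common prefix of the words f(xw), computes f and has this quotient as
   its transition monoid.  So f is V-definable iff the quotient lies in V.

   For T with n states, a Moore-style stabilisation argument on pairs of states
   shows that words of length at most (n+1)^(n+1) + (n+1)^2 suffice to test
   congruence and to represent all classes.  The multiplication table of the
   quotient is therefore computable from T, and it is fed to the decision
   procedure for V. *)

(** * Congruence and normalised outputs of a word function *)

Section Strip.
Variable B : eqType.
Implicit Types s t : seq B.

Definition strip_step (p : seq B * seq B) :=
  if (p.1 != [::]) && (ohead p.1 == ohead p.2) then (behead p.1, behead p.2)
  else p.

(** The reduced form of s^-1 t. Iterating one step, instead of recursing on both words, lets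
    computability follow from closure under [iter]; each effective step consumes a letter of [s], so
    [size s] rounds suffice. *)
Definition strip s t := iter (size s) strip_step (s, t).

Lemma strip_cons x s t : strip (x :: s) (x :: t) = strip s t.
Proof. by rewrite /strip /= -iterS iterSr /strip_step /= eqxx. Qed.

Lemma strip_ohead s t : ohead s != ohead t -> strip s t = (s, t).
Proof.
move=> st; apply: iter_fix.
by rewrite /strip_step /= (negbTE st) andbF.
Qed.

Lemma strip_cat r s t : strip (r ++ s) (r ++ t) = strip s t.
Proof. by elim: r => //= x r IHr; rewrite strip_cons. Qed.

Lemma stripP s t : exists c,
  [/\ s = c ++ (strip s t).1, t = c ++ (strip s t).2 &
      forall r, prefix r s -> prefix r t -> size r <= size c].
Proof.
elim: s t => [|x s IHs] [|y t].
- by exists [::]; split=> // -[].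
- by exists [::]; split=> // -[].
- by exists [::]; rewrite strip_ohead //; split=> // -[].
have [<-|neq] := eqVneq x y.
  have [c [es et maxc]] := IHs t.
  exists (x :: c); rewrite strip_cons /= -es -et; split=> // -[|z r] //=.
  by move=> /andP[_ rs] /andP[_ rt]; apply: maxc.
exists [::]; rewrite strip_ohead //; split=> // -[|z r] //=.
by move=> /andP[/eqP-> _]; rewrite (negbTE neq).
Qed.

(** The word [y] is at least as long as [z] and so ends in it, y = r z; this one [r] serves both
    equations. *)
Lemma cat_overlap (a z c y b d : seq B) : size z <= size y ->
  a ++ z = c ++ y -> b ++ z = d ++ y ->
  exists r, a = c ++ r /\ b = d ++ r.
Proof.
move=> le Ea Eb.
have split2 e g : e ++ z = g ++ y -> e = g ++ drop (size g) e
    /\ drop (size g) e ++ z = y.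
  move=> E; have sz : size e + size z = size g + size y by rewrite -!size_cat E.
  have ge : size g <= size e by rewrite -(leq_add2r (size z)) sz leq_add2l.
  have ee : e = g ++ drop (size g) e.
    rewrite -[LHS](cat_take_drop (size g)); congr (_ ++ _).
    by rewrite -(takel_cat z ge) E take_size_cat.
  split=> //; apply/eqP; move/eqP: E.
  by rewrite {1}ee -catA eqseq_cat // eqxx.
have [ea ya] := split2 _ _ Ea; have [eb yb] := split2 _ _ Eb.
exists (drop (size c) a); split=> //; rewrite eb; congr (_ ++ _).
have /eqP : drop (size d) b ++ z = drop (size c) a ++ z by rewrite ya yb.
rewrite eqseq_cat; first by rewrite eqxx andbT => /eqP.
by apply: (@addIn (size z)); rewrite -!size_cat ya yb.
Qed.

Lemma strip_swap s t : strip s t = ((strip t s).2, (strip t s).1).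
Proof.
elim: s t => [|x s IHs] [|y t] //.
- by rewrite [in RHS]strip_ohead.
- by rewrite strip_ohead.
have [<-|neq] := eqVneq x y; first by rewrite !strip_cons IHs.
have neq' : Some x != Some y by apply: contra neq => /eqP[->].
by rewrite !strip_ohead //= eq_sym.
Qed.

Lemma strip_sym s1 s2 t1 t2 : strip s1 s2 = strip t1 t2 ->
  strip s2 s1 = strip t2 t1.
Proof. by move=> e; rewrite strip_swap e -strip_swap. Qed.

(* Equality of stripped pairs is equality of the quotients [s1^-1 s2] and
   [t1^-1 t2] in the free group, hence compatible with composition. *)
Lemma strip_trans s1 s2 s3 t1 t2 t3 :
  strip s1 s2 = strip t1 t2 -> strip s2 s3 = strip t2 t3 ->
  strip s1 s3 = strip t1 t3.
Proof.
have [a [es1 es2 _]] := stripP s1 s2; have [b [et1 et2 _]] := stripP t1 t2.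
have [c [es2' es3 _]] := stripP s2 s3; have [d [et2' et3 _]] := stripP t2 t3.
move=> e12 e23; move: es1 es2 es2' es3; rewrite e12 e23.
move: (strip t1 t2) (strip t2 t3) et1 et2 et2' et3 => [z1 z2] [y2 y3] /=.
move=> -> -> E1 -> -> -> E2 ->.
(* Here s2 = a z2 = c y2 and t2 = b z2 = d y2. Whichever of [z2] and [y2] is shorter, the same [r]
   separates the two factorisations of [s2] and of [t2], and the remaining common prefixes
   cancel. *)
case/orP: (leq_total (size z2) (size y2)) => le.
  have [r [-> ->]] := cat_overlap le E2 E1.
  by rewrite -!catA !strip_cat.
have [r [-> ->]] := cat_overlap le (esym E2) (esym E1).
by rewrite -!catA !strip_cat.
Qed.

End Strip.

(** * Similarity of words and longest common prefixes of their values *)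

Section Quotient.
Variables A B : eqType.
Variable f : seq A -> option (seq B).
Variable W : seq (seq A).
Implicit Types u v w x y : seq A.

Definition delta x w1 w2 :=
  obind (fun s => omap (strip s) (f (x ++ w2))) (f (x ++ w1)).

(** [sim] and [cong] are the decidable versions of [Sim] and [Cong], with all quantifiers restricted
    to the finite list [W]. *)
Definition sim x y :=
  all (fun w1 => all (fun w2 => delta x w1 w2 == delta y w1 w2) W) W.

Definition cong u v := all (fun x => sim (x ++ u) (x ++ v)) W.

(** Taking the first congruent word of [W] makes the representative canonical. The default is
    reached only when [W] misses the class of [u]. *)
Definition rep u := nth [::] W (find (cong u) W).

Definition reps := undup (map rep W).

Definition idx u := index (rep u) reps.

(** Laid out like the data pickled by [fm_encode]: order, index of the unit, rows of products. *)
Definition mtable :=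
  (size reps, (idx [::], [seq [seq idx (u ++ v) | v <- reps] | u <- reps])).

Definition Sim x y := forall w1 w2, delta x w1 w2 = delta y w1 w2.

Definition Cong u v := forall x, Sim (x ++ u) (x ++ v).

Lemma delta_refl x w s : f (x ++ w) = Some s -> delta x w w = Some ([::], [::]).
Proof.
by rewrite /delta => -> /=; have := strip_cat s [::] [::]; rewrite !cats0 => ->.
Qed.

Lemma SimS x y : Sim x y -> Sim y x.
Proof. by move=> xy w1 w2. Qed.

Lemma Sim_catr x y w : Sim x y -> Sim (x ++ w) (y ++ w).
Proof.
by move=> xy w1 w2; have := xy (w ++ w1) (w ++ w2); rewrite /delta !catA.
Qed.

(** The diagonal quotient [delta x w w] is defined exactly when f(xw) is, so it detects the
    domain. *)
Lemma Sim_dom x y w s : Sim x y -> f (x ++ w) = Some s ->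
  exists t, f (y ++ w) = Some t.
Proof.
move=> xy fx; have := xy w w; rewrite (delta_refl fx) /delta.
by case: (f (y ++ w)) => [t|] //=; exists t.
Qed.

Lemma Sim_undef x y w : Sim x y -> f (x ++ w) = None -> f (y ++ w) = None.
Proof.
move=> xy fx; case fy: (f (y ++ w)) => [t|] //.
by have [s] := Sim_dom (SimS xy) fy; rewrite fx.
Qed.

Lemma Sim_strip x y w w' s s' t t' : Sim x y ->
  f (x ++ w) = Some s -> f (x ++ w') = Some s' ->
  f (y ++ w) = Some t -> f (y ++ w') = Some t' -> strip s s' = strip t t'.
Proof.
by move=> xy e1 e2 e3 e4; have := xy w w'; rewrite /delta e1 e2 e3 e4 => -[].
Qed.

Lemma Cong_Sim u v : Cong u v -> Sim u v.
Proof. by move=> uv; apply: (uv [::]). Qed.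

Lemma CongS u v : Cong u v -> Cong v u.
Proof. by move=> uv x; apply: SimS. Qed.

Lemma CongT u v w : Cong u v -> Cong v w -> Cong u w.
Proof. by move=> uv vw x w1 w2; rewrite uv vw. Qed.

Lemma Cong_cat u u' v v' : Cong u u' -> Cong v v' -> Cong (u ++ v) (u' ++ v').
Proof.
move=> uu vv x w1 w2; rewrite !catA (Sim_catr v (uu x)) //.
by rewrite vv.
Qed.

(** If [x] has no continuation in the domain, every word qualifies and there is no longest one;
    hence the assumption of a defined value in the results on [lcp]. *)
Definition common_prefix x p := forall w s, f (x ++ w) = Some s -> prefix p s.

Definition lcp_of x p := common_prefix x p /\
  forall q, common_prefix x q -> size q <= size p.

Lemma lcp_exists x w s : f (x ++ w) = Some s -> exists p, lcp_of x p.
Proof.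
move=> fx.
have bd q : common_prefix x q -> size q <= size s.
  by move=> /(_ _ _ fx) /prefixP[r ->]; rewrite size_cat leq_addr.
have : common_prefix x [::] by move=> *; rewrite prefix0s.
have : size s <= size s + size (@nil B) by rewrite leq_addr.
(* Induction on a bound for how far [p] falls short of [size s], starting from the empty prefix; at
   zero, [p] is already maximal. *)
elim: {2}(size s) [::] => [|n IHn] p le cp.
  by exists p; split=> // q /bd /leq_trans; apply.
have [max|nmax] := classic (forall q, common_prefix x q -> size q <= size p).
  by exists p.
have [q nq] := not_all_ex_not _ _ nmax.
have [cq /negP] := imply_to_and _ _ nq; rewrite -ltnNge => lt.
apply: (IHn q) => //; apply: leq_trans le _.
by rewrite addSnnS leq_add2l.
Qed.

(** Classical choice is harmless: [lcp] enters only a transducer whose existence is asserted, never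
    the algorithm. *)
Definition lcp x : seq B := epsilon (inhabits [::]) (lcp_of x).

Lemma lcpP x w s : f (x ++ w) = Some s -> lcp_of x (lcp x).
Proof. by move=> /lcp_exists ex; apply: epsilon_spec. Qed.

Lemma lcp_prefix x w s : f (x ++ w) = Some s ->
  exists r, s = lcp x ++ r.
Proof. by move=> fx; have [/(_ _ _ fx) /prefixP] := lcpP fx. Qed.

(** Against any other value at [x], the part of f(xw) left after cancellation has at most [size r]
    letters, since [lcp x] cancels. By similarity the same part is left of f(yw). Were [r'] longer
    than [r], all values at [y] would share [size r' - size r] letters beyond [lcp y], against
    maximality. *)
Lemma Sim_rest_le x y w r r' : Sim x y -> f (x ++ w) = Some (lcp x ++ r) ->
  f (y ++ w) = Some (lcp y ++ r') -> size r' <= size r.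
Proof.
move=> xy fx fy; rewrite leqNgt; apply/negP => lt.
have [_ maxy] := lcpP fy; set Q := lcp y in fy maxy *.
pose Q' := take (size Q + (size r' - size r)) (Q ++ r').
have szQ' : size Q' = size Q + (size r' - size r).
  by rewrite size_takel // size_cat leq_add2l leq_subr.
suff /maxy : common_prefix y Q'.
  by rewrite szQ' -[X in _ <= X]addn0 leq_add2l leqNgt subn_gt0 lt.
move=> v t fyv; have [s fxv] := Sim_dom (SimS xy) fyv.
have := Sim_strip xy fx fxv fy fyv.
have [[cpx _] [c [ec ec' maxc]]] := (lcpP fx, stripP (lcp x ++ r) s).
have [d [ed ed' _]] := stripP (Q ++ r') t.
move=> e; move: ec ec' ed ed'; rewrite e; case: (strip _ t) => z z' /= ec ec' ed ed'.
have lez : size z <= size r.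
  have lc : size (lcp x) <= size c.
    by apply: maxc; [rewrite prefix_prefix | apply: cpx fxv].
  rewrite -(leq_add2l (size (lcp x))) -[X in _ <= X]size_cat ec size_cat.
  by rewrite leq_add2r.
have led : size Q' <= size d.
  rewrite szQ' -(leq_add2r (size z)) -[X in _ <= X]size_cat -ed size_cat -addnA.
  by rewrite leq_add2l -[X in _ <= X](subnK (ltnW lt)) leq_add2l.
rewrite ed' -(cat_take_drop (size Q') d) -catA.
suff -> : take (size Q') d = Q' by rewrite prefix_prefix.
by rewrite -(takel_cat z led) -ed /Q' szQ'.
Qed.

(** The lengths agree by [Sim_rest_le] in both directions. If [r] starts with [b], maximality of
    [lcp x] gives a value f(xv) not extending [lcp x] by [b]. Cancelling it against f(xw) leaves a
    word [z] ending in [r]; by similarity [z] also ends in [r']. *)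
Lemma Sim_rest x y w r r' : Sim x y -> f (x ++ w) = Some (lcp x ++ r) ->
  f (y ++ w) = Some (lcp y ++ r') -> r = r'.
Proof.
move=> xy fx fy.
have szr : size r = size r'.
  apply/eqP; rewrite eqn_leq (Sim_rest_le (SimS xy) fy fx).
  by rewrite (Sim_rest_le xy fx fy).
case: r szr fx => [|b r] szr fx; first by case: r' szr {fy}.
have [cpx maxx] := lcpP fx.
have ncp : ~ common_prefix x (lcp x ++ [:: b]).
  by move=> /maxx; rewrite size_cat addn1 ltnn.
have [v nv] := not_all_ex_not _ _ ncp; have [s ns] := not_all_ex_not _ _ nv.
have [fxv nps] := imply_to_and _ _ ns.
have [t fyv] := Sim_dom xy fxv.
have := Sim_strip xy fx fxv fy fyv.
have [c [ec ec' _]] := stripP (lcp x ++ b :: r) s.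
have [d [ed _ _]] := stripP (lcp y ++ r') t.
move=> e; move: ec ec' ed; rewrite e; case: (strip _ t) => z z' /= ec ec' ed.
have lec : size c <= size (lcp x).
  rewrite leqNgt; apply/negP => lt; apply: nps.
  have: prefix (lcp x ++ [:: b]) c.
    rewrite prefixE; apply/eqP; rewrite -(takel_cat z) -?ec.
      by rewrite -[b :: r]cat1s catA take_size_cat.
    by rewrite size_cat addn1.
  by move=> /prefixP[c' ecc]; rewrite ec' ecc -catA prefix_prefix.
have /prefixP[a ea] : prefix c (lcp x).
  by rewrite prefixE -(takel_cat (b :: r) lec) ec take_size_cat.
have suf (T : eqType) (p q g h : seq T) :
    p ++ q = g ++ h -> size q <= size h -> exists k, h = k ++ q.
  move=> E le; have [l [el _]] := cat_overlap le E E; exists l.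
  by move/eqP: E; rewrite el -catA eqseq_cat // eqxx => /eqP.
have [k ek] : exists k, z = k ++ b :: r.
  by apply: (suf _ (lcp x) _ c) => //; move: ec; rewrite ea -catA => /eqP;
  rewrite eqseq_cat // eqxx /= => /eqP <-; rewrite size_cat leq_addl.
have [k' ek'] : exists k', z = k' ++ r'.
  by apply: (suf _ (lcp y) _ d) => //; rewrite -szr ek size_cat leq_addl.
have /eqP := ek'; rewrite ek eqseq_cat; first by move=> /andP[_ /eqP].
have : size (k ++ b :: r) = size (k' ++ r') by rewrite -ek ek'.
by rewrite !size_cat szr => /addIn.
Qed.

(* The transition output [lcp(x)^-1 lcp(xw)] only depends on the class of x. *)
Lemma lcp_step x y w v s : Sim x y -> f (x ++ w ++ v) = Some s ->
  lcp (x ++ w) = lcp x ++ drop (size (lcp y)) (lcp (y ++ w)).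
Proof.
move=> xy fx; have [t fy] := Sim_dom xy fx.
have xyw := Sim_catr w xy.
have fx' : f ((x ++ w) ++ v) = Some s by rewrite -catA.
have fy' : f ((y ++ w) ++ v) = Some t by rewrite -catA.
have [r1 e1] := lcp_prefix fx; have [r2 e2] := lcp_prefix fx'.
have [r3 e3] := lcp_prefix fy; have [r4 e4] := lcp_prefix fy'.
(* The same value is split after the prefix of [x] and after that of [xw]; similarity transfers both
   remainders to [y] and [yw], and comparing them isolates the step. *)
have e13 := Sim_rest xy (etrans fx (congr1 Some e1)) (etrans fy (congr1 Some e3)).
have e24 :=
  Sim_rest xyw (etrans fx' (congr1 Some e2)) (etrans fy' (congr1 Some e4)).
have [cpy _] := lcpP fy; have [_ maxyw] := lcpP fy'.
have le : size (lcp y) <= size (lcp (y ++ w)).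
  apply: maxyw => v' s'; rewrite -catA; exact: cpy.
have ed : lcp (y ++ w) = lcp y ++ drop (size (lcp y)) (lcp (y ++ w)).
  rewrite -[LHS](cat_take_drop (size (lcp y))); congr (_ ++ _).
  by rewrite -(takel_cat r4 le) -e4 e3 take_size_cat.
have e : r3 = drop (size (lcp y)) (lcp (y ++ w)) ++ r4.
  have /eqP := e4; rewrite e3 {1}ed -catA eqseq_cat // eqxx /=.
  by move=> /eqP.
have /eqP := e2; rewrite e1 e13 e e24 catA.
rewrite eqseq_cat; first by rewrite eqxx andbT => /eqP <-.
by have := congr1 size e1; rewrite e2 e13 e e24 !size_cat addnA => /addIn ->.
Qed.

End Quotient.

(** * The quotient as a transition monoid *)

Lemma Cong_ext (A B : eqType) (f g : seq A -> option (seq B)) u v :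
  f =1 g -> Cong f u v -> Cong g u v.
Proof. by move=> fg uv x w1 w2; have := uv x w1 w2; rewrite /delta !fg. Qed.

Lemma delta_omap_cat (A B : eqType) (f g : seq A -> option (seq B)) (s : seq B)
    (x y w1 w2 : seq A) :
  (forall w, f (x ++ w) = omap (cat s) (g (y ++ w))) ->
  delta f x w1 w2 = delta g y w1 w2.
Proof.
move=> fg; rewrite /delta !fg.
case: (g (y ++ w1)) => [s1|] //=; case: (g (y ++ w2)) => [s2|] //=.
by rewrite strip_cat.
Qed.

(** * Action and output of a transducer on its states *)

Section Transducer.
Variables (k : nat) (T : dft k).
Local Notation Q := 'I_(d_n T).
Implicit Types (p : option Q) (u v w x : seq 'I_k).

(** [None] serves as a sink state, which makes the action of words total. *)
Definition sact p u : option Q := obind (fun q => omap fst (drun T q u)) p.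

Definition sout p u : option (seq 'I_k) :=
  obind (fun q => obind (fun ro => omap (cat ro.2) (d_term T ro.1)) (drun T q u)) p.

Lemma drun_cat (q : Q) u v : drun T q (u ++ v) =
  obind (fun ro => omap (fun so => (so.1, ro.2 ++ so.2)) (drun T ro.1 v))
        (drun T q u).
Proof.
elim: u q => [|a u IHu] q /=; first by case: (drun T q v) => [[]|].
case: (d_delta T q a) => [[r o]|] //=; rewrite IHu.
case: (drun T r u) => [[s o']|] //=.
by case: (drun T s v) => [[s' o'']|] //=; rewrite catA.
Qed.

Lemma sact_cat p u v : sact p (u ++ v) = sact (sact p u) v.
Proof.
case: p => [q|] //=; rewrite drun_cat; case: (drun T q u) => [[r o]|] //=.
by case: (drun T r v) => [[]|].
Qed.

Lemma sout_cat p u v : sout p (u ++ v) =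
  obind (fun q => obind (fun ro => omap (cat ro.2) (sout (Some ro.1) v))
                        (drun T q u)) p.
Proof.
case: p => [q|] //=; rewrite drun_cat; case: (drun T q u) => [[r o]|] //=.
case: (drun T r v) => [[r' o']|] //=; case: (d_term T r') => [t|] //=.
by rewrite catA.
Qed.

Lemma dfun_sout u : dfun T u = omap (cat (d_iout T)) (sout (Some (d_init T)) u).
Proof.
rewrite /dfun /=; case: (drun T _ u) => [[q o]|] //=.
by case: (d_term T q).
Qed.

(** The output along [u] is common to both values and cancels, so the quotient depends only on the
    state reached. This is why [Cong] has finite index. *)
Lemma delta_sout p u w1 w2 :
  delta (sout p) u w1 w2 = delta (sout (sact p u)) [::] w1 w2.
Proof.
rewrite /sact; case: p => [q|] //=.
case e: (drun T q u) => [[r o]|] /=; last by rewrite /delta !sout_cat /= e.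
by apply: (delta_omap_cat (s := o)) => w; rewrite sout_cat /= e.
Qed.

Lemma delta_dfun x w1 w2 : delta (dfun T) x w1 w2 =
  delta (sout (sact (Some (d_init T)) x)) [::] w1 w2.
Proof.
rewrite -delta_sout; apply: (delta_omap_cat (s := d_iout T)) => w.
exact: dfun_sout.
Qed.

(** By determinism the run relation of a word is the graph of its action. *)
Lemma trans_equivP u v : trans_equiv T u v <-> forall p, sact p u = sact p v.
Proof.
have runP (q r : Q) w :
    (exists o, drun T q w = Some (r, o)) <-> sact (Some q) w = Some r.
  rewrite /=; case: (drun T q w) => [[s o]|] /=; last by split=> // -[].
  by split=> [[o' [-> _]] //|[<-]]; exists o.
split=> [uv [q|] //|uv q r]; last by rewrite !runP uv.
case eu: (sact _ u) => [r|].
  by apply/esym/runP/uv/runP.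
case ev: (sact _ v) => [r|] //.
by rewrite -eu; apply/runP/uv/runP.
Qed.

Lemma sact_Cong u v : (forall p, sact p u = sact p v) -> Cong (dfun T) u v.
Proof. by move=> uv x w1 w2; rewrite !delta_dfun !sact_cat uv. Qed.

End Transducer.

(** * The quotient monoid and its Cayley transducer *)

Section QuotientMonoid.
Variables (k : nat) (f : seq 'I_k -> option (seq 'I_k)) (W : seq (seq 'I_k)).
Hypothesis congP : forall u v, cong f W u v <-> Cong f u v.
Hypothesis W_full : forall u, exists2 v, v \in W & Cong f u v.
Local Notation crep := (rep f W).
Local Notation creps := (reps f W).
Local Notation cidx := (idx f W).

Lemma Cong_rep u : Cong f u (crep u).
Proof.
apply/congP/nth_find/hasP; have [v vW uv] := W_full u.
by exists v => //; apply/congP.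
Qed.

Lemma rep_in u : crep u \in W.
Proof.
rewrite mem_nth // -has_find; have [v vW uv] := W_full u.
by apply/hasP; exists v => //; apply/congP.
Qed.

Lemma rep_eq u v : crep u = crep v <-> Cong f u v.
Proof.
split=> [e|uv].
  by apply: CongT (Cong_rep u) _; rewrite e; apply/CongS/Cong_rep.
rewrite /rep; congr nth; apply: eq_find => w.
by apply/idP/idP => /congP h; apply/congP; apply: CongT h; [apply: CongS|].
Qed.

Lemma rep_reps u : crep u \in creps.
Proof.
rewrite mem_undup; have -> : crep u = crep (crep u).
  by apply/rep_eq/Cong_rep.
by rewrite map_f // rep_in.
Qed.

Lemma idx_lt u : cidx u < size creps.
Proof. by rewrite index_mem rep_reps. Qed.

Definition phi u : 'I_(size creps) := Ordinal (idx_lt u).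

Definition word (i : 'I_(size creps)) := nth [::] creps i.

Lemma word_phi u : word (phi u) = crep u.
Proof. exact: nth_index (rep_reps u). Qed.

Lemma Cong_word u : Cong f u (word (phi u)).
Proof. by rewrite word_phi; apply: Cong_rep. Qed.

Lemma phiP u v : phi u = phi v <-> Cong f u v.
Proof.
rewrite -rep_eq; split=> [e|e]; first by rewrite -!word_phi e.
by apply: val_inj; rewrite /= /idx e.
Qed.

Lemma phi_word i : phi (word i) = i.
Proof.
apply: val_inj; rewrite /= /idx.
have : word i \in creps by rewrite mem_nth.
rewrite {1}mem_undup => /mapP[u _ e].
have -> : crep (word i) = word i by rewrite e; apply/rep_eq/CongS/Cong_rep.
by rewrite index_uniq ?undup_uniq.
Qed.

Definition qmul i j := phi (word i ++ word j).

Lemma phi_cat u v : phi (u ++ v) = qmul (phi u) (phi v).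
Proof. by apply/phiP/Cong_cat; apply: Cong_word. Qed.

Lemma qmulA x y z : qmul x (qmul y z) = qmul (qmul x y) z.
Proof.
by rewrite -(phi_word x) -(phi_word y) -(phi_word z) -!phi_cat catA.
Qed.

Lemma qmul1 x : qmul (phi [::]) x = x.
Proof. by rewrite -{1}(phi_word x) -phi_cat phi_word. Qed.

Lemma qmulr1 x : qmul x (phi [::]) = x.
Proof. by rewrite -{1}(phi_word x) -phi_cat cats0 phi_word. Qed.

Definition qmon := FMon qmulA qmul1 qmulr1.

(** The link between the abstract monoid and the table that the program outputs. *)
Lemma fm_encode_qmon : fm_encode qmon = pickle (mtable f W).
Proof.
rewrite /fm_encode /mtable /=.
have er : [seq word i | i <- enum 'I_(size creps)] = creps.
  by rewrite (map_comp (nth [::] creps) val) val_enum_ord; apply: mkseq_nth.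
have map_reps C (g : seq 'I_k -> C) :
    [seq g u | u <- creps] = [seq g (word i) | i <- enum 'I_(size creps)].
  by rewrite -[in LHS]er -map_comp.
congr (pickle (_, (_, _))); rewrite map_reps.
by apply: eq_map => i; rewrite map_reps.
Qed.

(** Since the transition congruence refines [Cong], mapping an element of [M] to the class of any
    word representing it is well defined; the submonoid is all of [M]. *)
Lemma qmon_divides (T : dft k) (M : fmon) :
  dfun T =1 f -> is_transition_monoid T M -> divides qmon M.
Proof.
move=> Tf [psi [psi0 psiM psi_surj psiP]].
have psiE m : exists u, psi u == m by have [u <-] := psi_surj m; exists u.
pose h m := phi (xchoose (psiE m)).
have hpsi u : h (psi u) = phi u.
  apply/phiP; have /eqP/psiP/trans_equivP := xchooseP (psiE (psi u)).
  by move=> /sact_Cong; apply: Cong_ext.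
exists (fun=> true), h; split=> //.
- by rewrite -psi0 hpsi.
- move=> x y _ _; have [[u <-] [v <-]] := (psi_surj x, psi_surj y).
  by rewrite -psiM !hpsi phi_cat.
- by move=> m; exists (psi (word m)); rewrite hpsi phi_word.
Qed.

(** Outputs are computed at the representative of a class. From a class without defined continuation
    they are arbitrary, but no such run reaches a final state. *)
Definition cayley : dft k := {|
  d_n := size creps;
  d_init := phi [::];
  d_delta := fun i a => Some (qmul i (phi [:: a]),
    drop (size (lcp f (word i))) (lcp f (word i ++ [:: a])));
  d_iout := lcp f [::];
  d_term := fun i => omap (drop (size (lcp f (word i)))) (f (word i)) |}.

(** The outputs lcp(x)^-1 lcp(xa) telescope. A defined continuation is required for the prefixes to
    be meaningful. *)
Lemma drun_cayley x u : exists2 o, drun cayley (phi x) u = Some (phi (x ++ u), o) &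
  forall s w, f (x ++ u ++ w) = Some s -> lcp f x ++ o = lcp f (x ++ u).
Proof.
elim: u x => [|a u IHu] x; first by exists [::]; rewrite ?cats0 //= => *; rewrite ?cats0.
rewrite [drun _ _ _]/= -phi_cat; have [o -> ho] := IHu (x ++ [:: a]).
exists (drop (size (lcp f (word (phi x)))) (lcp f (word (phi x) ++ [:: a])) ++ o).
  by rewrite -catA.
move=> s w fx; rewrite catA.
have fx' : f (x ++ [:: a] ++ u ++ w) = Some s by [].
(* The transition reads its output off the representative of [x]; [lcp_step] transfers it to [x]
   itself. *)
rewrite -(lcp_step (Cong_Sim (Cong_word x)) fx') (ho s w) -?catA //.
Qed.

(** The run outputs lcp(u), and by [Sim_rest] the terminal output, read off the representative, is
    what f(u) has left after it. *)
Lemma dfun_cayley u : dfun cayley u = f u.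
Proof.
rewrite /dfun; have [o -> ho] := drun_cayley [::] u.
rewrite cat0s /=; have xy := Cong_Sim (Cong_word u).
case fu: (f u) => [s|]; last first.
  have := Sim_undef (w := [::]) xy; rewrite !cats0 => /(_ fu).
  by move=> ->.
have fu' : f (u ++ [::]) = Some s by rewrite cats0.
have [t ft] := Sim_dom xy fu'.
have [r es] := lcp_prefix fu'; have [r' et] := lcp_prefix ft.
have er := Sim_rest xy (etrans fu' (congr1 Some es)) (etrans ft (congr1 Some et)).
have := ft; rewrite cats0 => -> /=.
by rewrite catA (ho s [::] fu') es er et drop_size_cat.
Qed.

(** Words act by right multiplication, which is faithful because the image of the unit recovers the
    class. *)
Lemma cayley_transition_monoid : is_transition_monoid cayley qmon.
Proof.
have act (i : 'I_(d_n cayley)) u : sact (Some i) u = Some (qmul i (phi u)).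
  rewrite /= -(phi_word i); have [o -> _] := drun_cayley (word i) u.
  by rewrite /= phi_cat.
exists phi; split=> //; first exact: phi_cat.
  by move=> m; exists (word m); apply: phi_word.
move=> u v; rewrite trans_equivP; split=> [e [i|] //|e].
  by rewrite !act e.
have := e (Some (phi [::])); rewrite !act !qmul1; exact: Some_inj.
Qed.

Lemma V_definable_qmon (V : fmon -> Prop) (HV : monoid_variety V) (T : dft k) :
  dfun T =1 f -> V_definable V T <-> V qmon.
Proof.
move=> Tf; split=> [[T' [[M [VM TM]] T'T]]|VM].
  apply: (mv_div HV) VM; apply: qmon_divides TM => u.
  by rewrite T'T Tf.
exists cayley; split; first by exists qmon; split=> //; apply: cayley_transition_monoid.
by move=> u; rewrite dfun_cayley Tf.
Qed.

End QuotientMonoid.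

(** * Bounds on test words *)

(** All words of length at most [n]. The alphabet is an explicit list, so the same definition serves
    ordinals and natural numbers. *)
Definition words (A : Type) (al : seq A) n : seq (seq A) :=
  iter n (fun ws => [::] :: flatten [seq [seq a :: w | w <- ws] | a <- al]) [:: [::]].

Lemma mem_words (A : finType) n (w : seq A) :
  (w \in words (enum A) n) = (size w <= n).
Proof.
elim: n w => [|n IHn] [|a w] //=; rewrite inE /= ltnS -IHn.
apply/flatten_mapP/idP => [[b _ /mapP[w' ? [_ ->]]] //|wn].
by exists a; rewrite ?mem_enum //; apply: map_f.
Qed.

(** The chain cannot grow strictly at all of the [#|P|.+1] indices from [n0] to [n0 + #|P|]; at the
    first repetition found there, stability freezes it forever. *)
Lemma increasing_stable (P : finType) (X : nat -> {set P}) n0 :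
  (forall n, X n \subset X n.+1) ->
  (forall n, n0 <= n -> X n = X n.+1 -> X n.+1 = X n.+2) ->
  forall N m, n0 + #|P| <= N -> X m \subset X N.
Proof.
move=> incr stab N m leN.
have mono i j : i <= j -> X i \subset X j.
  by move=> /subnK <-; elim: (j - i) => //= d IH; apply: subset_trans (incr _).
have [i [leni leiN ei]] : exists i, [/\ n0 <= i, i <= n0 + #|P| & X i = X i.+1].
  have [/existsP[i /eqP ei]|nex] :=
    boolP [exists i : 'I_#|P|.+1, X (n0 + i) == X (n0 + i).+1].
    by exists (n0 + i); rewrite leq_addr leq_add2l -ltnS.
  have card i : i <= #|P|.+1 -> i <= #|X (n0 + i)|.
    elim: i => // i IHi lti; apply: leq_ltn_trans (IHi (ltnW lti)) _.
    rewrite addnS; apply: proper_card; rewrite properEneq incr andbT.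
    by move/existsPn: nex => /(_ (Ordinal lti)).
  by have := leq_trans (card _ (leqnn _)) (max_card _); rewrite ltnn.
have stable d : X (i + d) = X i /\ X (i + d).+1 = X i.
  elim: d => [|d [IH1 IH2]]; first by rewrite addn0 -ei.
  rewrite addnS; split=> //; rewrite -[RHS]IH2; apply/esym/stab.
    exact: leq_trans leni (leq_addr _ _).
  by rewrite IH1.
have [le|/ltnW le] := leqP m i.
  by apply: mono (leq_trans le (leq_trans leiN leN)).
by rewrite -(subnKC le) (stable _).1 mono // (leq_trans leiN).
Qed.

Section Bound.
Variables (k : nat) (T : dft k).
Local Notation Q := 'I_(d_n T).
Implicit Types (p q : option Q) (u v w x : seq 'I_k).

Arguments sout : simpl never.

Definition tact u : {ffun option Q -> option Q} := [ffun p => sact p u].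

Lemma tact_cat u u' v v' : tact u = tact u' -> tact v = tact v' ->
  tact (u ++ v) = tact (u' ++ v').
Proof.
move=> /ffunP eu /ffunP ev; apply/ffunP => p; rewrite !ffunE !sact_cat.
by have := eu p; rewrite !ffunE => ->; have := ev (sact p u'); rewrite !ffunE.
Qed.

(** The number of self-maps of [option Q]. *)
Definition short_bound := (d_n T).+1 ^ (d_n T).+1.

(** The sets of maps induced by words of length at most [n] form a chain. Once it repeats, it is
    stable: after the first letter, the rest of a word can be replaced by a shorter one with the
    same action. *)
Lemma short_word u : exists2 v, size v <= short_bound & tact v = tact u.
Proof.
pose X n := [set g | g \in map tact (words (enum 'I_k) n)].
have X_in n w : size w <= n -> tact w \in X n.
  by move=> wn; rewrite inE map_f // mem_words.
have XP n g : g \in X n -> exists2 w, size w <= n & tact w = g.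
  by rewrite inE => /mapP[w]; rewrite mem_words => wn ->; exists w.
have incr n : X n \subset X n.+1.
  by apply/subsetP => g /XP[w wn <-]; apply: X_in; apply: leqW.
have stab n : 0 <= n -> X n = X n.+1 -> X n.+1 = X n.+2.
  move=> _ e; apply/eqP; rewrite eqEsubset incr; apply/subsetP => g.
  move=> /XP[[|a w] wn <-]; first exact: X_in.
  have : tact w \in X n by rewrite e X_in.
  move=> /XP[w' w'n ew]; rewrite -(cat1s a w).
  by rewrite -(tact_cat (erefl (tact [:: a])) ew); apply: X_in.
have card : #|{ffun option Q -> option Q}| = short_bound.
  by rewrite card_ffun !card_option card_ord.
have /subsetP := increasing_stable incr stab (size u) (leqnn _).
by move=> /(_ _ (X_in _ _ (leqnn _))) /XP; rewrite add0n card.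
Qed.

Definition sdelta p := delta (sout p) [::].

Lemma sdelta_cat p u w1 w2 :
  sdelta p (u ++ w1) (u ++ w2) = sdelta (sact p u) w1 w2.
Proof. by transitivity (delta (sout p) u w1 w2); [|apply: delta_sout]. Qed.

(** A short word with the action of [w] reaches the same final state, though its output may
    differ. *)
Lemma sout_short p w s : sout p w = Some s ->
  exists2 v, size v <= short_bound & exists t, sout p v = Some t.
Proof.
have [v vB /ffunP/(_ p)] := short_word w; rewrite !ffunE => e ew; exists v => //.
move: e ew; rewrite /sout; case: p => [q|] //=.
case: (drun T q w) => [[r o]|] //=; case: (drun T q v) => [[r' o']|] //=.
by move=> [->]; case: (d_term T r) => // t _; exists (o' ++ t).
Qed.

Definition eqs n p q := forall w1 w2, size w1 <= n -> size w2 <= n ->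
  sdelta p w1 w2 = sdelta q w1 w2.

Lemma eqs_le m n p q : m <= n -> eqs n p q -> eqs m p q.
Proof.
by move=> le h w1 w2 l1 l2; apply: h; [apply: leq_trans l1 le|apply: leq_trans l2 le].
Qed.

Lemma sdelta_None p w1 w2 : sout p w1 = None \/ sout p w2 = None ->
  sdelta p w1 w2 = None.
Proof.
by rewrite /sdelta /delta /= => -[->|->] //; case: (sout p w1).
Qed.

Lemma sdelta_Some p w1 w2 s1 s2 : sout p w1 = Some s1 -> sout p w2 = Some s2 ->
  sdelta p w1 w2 = Some (strip s1 s2).
Proof. by rewrite /sdelta /delta /= => -> ->. Qed.

Lemma sout_dom p q w s : sdelta p w w = sdelta q w w -> sout p w = Some s ->
  exists t, sout q w = Some t.
Proof.
move=> e ep; case eq: (sout q w) => [t|]; first by exists t.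
by move: e; rewrite (sdelta_Some ep ep) sdelta_None //; left.
Qed.

(** Moore refinement passes to successor states, but [w1] and [w2] may begin with different letters.
    Each is therefore linked to a short word with its own first letter, and the quotient factors as
    (w1^-1 v1)(v1^-1 v2)(v2^-1 w2); only the middle factor mixes letters, and it is short. *)
Lemma eqs_step n : short_bound <= n ->
  (forall p q, eqs n p q -> eqs n.+1 p q) ->
  forall p q, eqs n.+1 p q -> eqs n.+2 p q.
Proof.
move=> len stab p q epq.
(* Successors agree to depth [n] by [epq], and stability lifts this to [n.+1]. *)
have succ u : size u <= 1 -> eqs n.+1 (sact p u) (sact q u).
  move=> u1; apply: stab => w1 w2 l1 l2; rewrite -!sdelta_cat.
  by apply: epq; rewrite size_cat; apply: (leq_add u1).
have split w : size w <= n.+2 ->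
    exists u w', [/\ w = u ++ w', size u <= 1 & size w' <= n.+1].
  by case: w => [|a w] lw; [exists [::], [::]|exists [:: a], w].
(* A long word is compared with a short one sharing its first letter. *)
have short w s : size w <= n.+2 -> sout p w = Some s ->
    exists v t, [/\ size v <= n.+1, sout p v = Some t &
                 sdelta p w v = sdelta q w v].
  move=> /split[u [w' [-> u1 w'n]]] ew.
  have [o eu] : exists o, forall v, sout p (u ++ v) = omap (cat o) (sout (sact p u) v).
    move: ew; rewrite sout_cat; case: (p) => [r|] //=.
    case e: (drun T r u) => [[r' o]|] //= _; exists o => v.
    by rewrite sout_cat /= e /=.
  have := ew; rewrite eu; case ew': (sout _ w') => [s'|] // _.
  have [v' lv' [t' ev']] := sout_short ew'.
  exists (u ++ v'), (o ++ t'); split.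
  - by rewrite size_cat (leq_add u1) // (leq_trans lv').
  - by rewrite eu ev'.
  - rewrite !sdelta_cat; apply: succ => //.
    by apply: leq_trans lv' (leqW len).
have dom w : size w <= n.+2 -> sdelta p w w = sdelta q w w.
  move=> /split[u [w' [-> u1 w'n]]]; rewrite !sdelta_cat; exact: succ.
move=> w1 w2 l1 l2.
case e1: (sout p w1) => [s1|]; last first.
  rewrite !sdelta_None //; left=> //.
  case e: (sout q w1) => [t|] //.
  by have [s] := sout_dom (esym (dom w1 l1)) e; rewrite e1.
case e2: (sout p w2) => [s2|]; last first.
  rewrite !sdelta_None //; right=> //.
  case e: (sout q w2) => [t|] //.
  by have [s] := sout_dom (esym (dom w2 l2)) e; rewrite e2.
have [v1 [a1 [lv1 ea1 d1]]] := short _ _ l1 e1.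
have [v2 [a2 [lv2 ea2 d2]]] := short _ _ l2 e2.
have [t1 f1] := sout_dom (dom _ l1) e1; have [t2 f2] := sout_dom (dom _ l2) e2.
have [b1 eb1] := sout_dom (epq _ _ lv1 lv1) ea1.
have [b2 eb2] := sout_dom (epq _ _ lv2 lv2) ea2.
have dv := epq _ _ lv1 lv2.
rewrite (sdelta_Some e1 e2) (sdelta_Some f1 f2); congr Some.
move: d1 d2 dv; rewrite (sdelta_Some e1 ea1) (sdelta_Some f1 eb1).
rewrite (sdelta_Some e2 ea2) (sdelta_Some f2 eb2).
rewrite (sdelta_Some ea1 ea2) (sdelta_Some eb1 eb2) => -[d1] [d2] [dv].
apply: strip_trans d1 _; apply: strip_trans dv _; exact: strip_sym.
Qed.

(** Stability is available from [short_bound] on; the second summand counts the pairs of states,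
    sink included. *)
Definition bound := short_bound + (d_n T).+1 * (d_n T).+1.

Lemma eqsP n p q : reflect (eqs n p q)
  (all (fun w1 => all (fun w2 => sdelta p w1 w2 == sdelta q w1 w2)
    (words (enum 'I_k) n)) (words (enum 'I_k) n)).
Proof.
apply: (iffP allP) => [h w1 w2 l1 l2|h w1].
  have /allP : all (fun w2 => sdelta p w1 w2 == sdelta q w1 w2) (words (enum 'I_k) n).
    by apply: h; rewrite mem_words.
  by move=> /(_ w2); rewrite mem_words => /(_ l2) /eqP.
by rewrite mem_words => l1; apply/allP => w2; rewrite mem_words => l2; apply/eqP/h.
Qed.

Lemma eqs_bound p q : eqs bound p q -> forall w1 w2, sdelta p w1 w2 = sdelta q w1 w2.
Proof.
move=> epq w1 w2.
(* [X n] collects the pairs separated at depth [n]; taking complements turns the decreasing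
   equivalences into an increasing chain. *)
pose X n := [set r : option Q * option Q | ~~ all (fun w1 => all (fun w2 =>
  sdelta r.1 w1 w2 == sdelta r.2 w1 w2) (words (enum 'I_k) n)) (words (enum 'I_k) n)].
have XP n p' q' : reflect (eqs n p' q') ((p', q') \notin X n).
  by rewrite inE negbK; apply: eqsP.
have incr n : X n \subset X n.+1.
  apply/subsetP => -[p' q']; apply: contraTT => /XP h; apply/XP.
  exact: eqs_le h.
have stab n : short_bound <= n -> X n = X n.+1 -> X n.+1 = X n.+2.
  move=> len e; apply/eqP; rewrite eqEsubset incr; apply/subsetP => -[p' q'].
  apply: contraTT => /XP h; apply/XP; apply: eqs_step h => // p'' q'' /XP.
  by rewrite e => /XP.
pose n := maxn (size w1) (size w2).
have card : short_bound + #|{: option Q * option Q}| <= bound.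
  by rewrite card_prod !card_option card_ord.
have /subsetP/(_ (p, q)) := increasing_stable incr stab n card.
have /XP/negbTE-> := epq => h.
have /XP : (p, q) \notin X n by apply/negP => /h.
by apply; rewrite ?leq_maxl ?leq_maxr.
Qed.

Local Notation W := (words (enum 'I_k) bound).

Lemma short_mem u : size u <= short_bound -> u \in W.
Proof. by move=> l; rewrite mem_words (leq_trans l) ?leq_addr. Qed.

Lemma simP x y : reflect (Sim (dfun T) x y) (sim (dfun T) W x y).
Proof.
have -> : sim (dfun T) W x y = all (fun w1 => all (fun w2 =>
    sdelta (sact (Some (d_init T)) x) w1 w2 ==
    sdelta (sact (Some (d_init T)) y) w1 w2) W) W.
  by apply: eq_all => w1; apply: eq_all => w2; rewrite !delta_dfun.
apply: (iffP (eqsP _ _ _)) => [/eqs_bound h w1 w2|h w1 w2 _ _].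
  by rewrite !delta_dfun; apply: h.
by rewrite /sdelta -!delta_dfun.
Qed.

(** Continuations are bounded by [simP]; a left context matters only through its action, so a short
    one replaces it. *)
Lemma congP u v : cong (dfun T) W u v <-> Cong (dfun T) u v.
Proof.
split=> [/allP h x|h]; last by apply/allP => x _; apply/simP.
have [x' /short_mem/h/simP e /ffunP/(_ (Some (d_init T)))] := short_word x.
rewrite !ffunE => ex w1 w2; have := e w1 w2.
by rewrite !delta_dfun !sact_cat ex.
Qed.

Lemma W_full u : exists2 v, v \in W & Cong (dfun T) u v.
Proof.
have [v /short_mem vW /ffunP e] := short_word u; exists v => //.
by apply: sact_Cong => p; have := e p; rewrite !ffunE.
Qed.

End Bound.

(** * Computable functions between countable types *)

Definition crec n (F : seq nat -> nat) :=
  exists c, forall v, size v = n -> eval c v (F v).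

Lemma crec_proj n i : i < n -> crec n (fun v => nth 0 v i).
Proof. by move=> lt; exists (cProj i) => v vn; apply: ev_proj; rewrite vn. Qed.

Lemma evals1 c v x : eval c v x -> evals [:: c] v [:: x].
Proof. by move=> h; do ?constructor. Qed.

Lemma crec_succ n F : crec n F -> crec n (fun v => (F v).+1).
Proof.
move=> [c hc]; exists (cComp cSucc [:: c]) => v /hc h.
by apply: ev_comp (evals1 h) _; apply: ev_succ.
Qed.

Lemma crec_const n k : crec n (fun=> k).
Proof.
elim: k => [|k IHk]; last exact: crec_succ.
by exists cZero => v _; apply: ev_zero.
Qed.

Lemma evals_drop d n v : size v = d + n ->
  evals [seq cProj i | i <- iota d n] v (drop d v).
Proof.
elim: n d => [|n IHn] d vn; first by rewrite drop_oversize ?vn ?addn0 //; constructor.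
have lt : d < size v by rewrite vn addnS ltnS leq_addr.
rewrite (drop_nth 0 lt) /=; constructor; first exact: ev_proj.
by apply: IHn; rewrite vn addSnnS.
Qed.

(** Weakening, used under the index and accumulator bound by [crec_iteri]. *)
Lemma crec_drop d n F : crec n F -> crec (d + n) (fun v => F (drop d v)).
Proof.
move=> [c hc]; exists (cComp c [seq cProj i | i <- iota d n]) => v vn.
by apply: ev_comp (evals_drop vn) _; apply: hc; rewrite size_drop vn addKn.
Qed.

Lemma crec_iteri n (N A : seq nat -> nat) (S : nat -> nat -> seq nat -> nat) :
  crec n.+2 (fun w => S (nth 0 w 0) (nth 0 w 1) (drop 2 w)) ->
  crec n N -> crec n A -> crec n (fun v => iteri (N v) (fun i r => S i r v) (A v)).
Proof.
move=> [cs hs] [cn hn] [ca ha].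
exists (cComp (cPrim ca cs) (cn :: [seq cProj i | i <- iota 0 n])) => v vn.
have ev : evals (cn :: [seq cProj i | i <- iota 0 n]) v (N v :: v).
  constructor; first exact: hn.
  by have := @evals_drop 0 n v vn; rewrite drop0.
apply: (ev_comp ev); elim: (N v) => [|m IHm] /=; first by apply/ev_prim0/ha.
apply: ev_primS IHm _; set r := iteri _ _ _.
have := hs [:: m, r & v]; rewrite /= drop0 vn; exact.
Qed.

Lemma crec_app1 n G F : crec 1 (fun v => G (nth 0 v 0)) -> crec n F ->
  crec n (fun v => G (F v)).
Proof.
move=> [cg hg] [cf hf]; exists (cComp cg [:: cf]) => v /hf h.
by apply: ev_comp (evals1 h) _; apply: (hg [:: F v]).
Qed.

Section NatFunctions.
Variable n : nat.
Implicit Types F G H : seq nat -> nat.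

Lemma crec_is0 F : crec n F -> crec n (fun v => F v == 0).
Proof.
move=> cF; suff [c hc] : crec n (fun v => iteri (F v) (fun _ _ => 0) 1).
  by exists c => v /hc; case: (F v).
by apply: (crec_iteri (S := fun _ _ _ => 0)) cF _; apply: crec_const.
Qed.

(** Iterating a constant function [F v] times: no round leaves [G v], any positive number of rounds
    gives [H v]. *)
Lemma crec_ite F G H : crec n F -> crec n G -> crec n H ->
  crec n (fun v => if F v == 0 then G v else H v).
Proof.
move=> cF cG cH; suff [c hc] : crec n (fun v => iteri (F v) (fun _ _ => H v) (G v)).
  by exists c => v /hc; case: (F v).
by apply: (crec_iteri (S := fun _ _ => H)) cF cG; apply: (crec_drop 2).
Qed.

Lemma crec_add F G : crec n F -> crec n G -> crec n (fun v => F v + G v).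
Proof.
move=> cF cG; suff [c hc] : crec n (fun v => iteri (F v) (fun _ r => r.+1) (G v)).
  exists c => v /hc; congr (eval _ _ _).
  by elim: (F v) => //= m ->.
by apply: (crec_iteri (S := fun _ r _ => r.+1)) cF cG; apply/crec_succ/crec_proj.
Qed.

Lemma crec_pred F : crec n F -> crec n (fun v => (F v).-1).
Proof.
move=> cF; suff [c hc] : crec n (fun v => iteri (F v) (fun i _ => i) 0).
  by exists c => v /hc; case: (F v).
by apply: (crec_iteri (S := fun i _ _ => i)) cF _; [apply: crec_proj|apply: crec_const].
Qed.
End NatFunctions.

Lemma crec_sub n F G : crec n F -> crec n G -> crec n (fun v => F v - G v).
Proof.
move=> cF cG; suff [c hc] : crec n (fun v => iteri (G v) (fun _ r => r.-1) (F v)).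
  exists c => v /hc; congr (eval _ _ _).
  by elim: (G v) => //= [|m ->]; rewrite ?subn0 ?subnS.
by apply: (crec_iteri (S := fun _ r _ => r.-1)) cG cF; apply/crec_pred/crec_proj.
Qed.

Lemma crec_eq n F G : crec n F -> crec n G -> crec n (fun v => F v == G v).
Proof.
move=> cF cG.
have [c hc] := crec_is0 (crec_add (crec_sub cF cG) (crec_sub cG cF)).
by exists c => v /hc; rewrite addn_eq0 !subn_eq0 -eqn_leq.
Qed.

Lemma crec_odd n F : crec n F -> crec n (fun v => odd (F v)).
Proof.
move=> cF; suff [c hc] : crec n (fun v => iteri (F v) (fun _ r => (r == 0 : nat)) 0).
  exists c => v /hc; congr (eval _ _ _).
  by elim: (F v) => //= m ->; case: odd.
apply: (crec_iteri (S := fun _ r _ => (r == 0 : nat))) cF _.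
  exact/crec_is0/crec_proj.
exact: crec_const.
Qed.

Lemma crec_half n F : crec n F -> crec n (fun v => (F v)./2).
Proof.
move=> cF; suff [c hc] : crec n (fun v => iteri (F v) (fun i r => odd i + r) 0).
  exists c => v /hc; congr (eval _ _ _).
  by elim: (F v) => //= m ->; rewrite -uphalf_half.
apply: (crec_iteri (S := fun i r _ => odd i + r)) cF _; last exact: crec_const.
by apply: crec_add; [apply: crec_odd|]; apply: crec_proj.
Qed.

(* One layer of [CodeSeq.code]. *)
Definition ncons a b := 2 ^ a * b.*2.+1.
Definition nhead m := iteri m (fun _ r => ~~ odd (iter r half m) + r) 0.
Definition ntail m := (iter (nhead m) half m)./2.

Lemma iter_half_ncons i a b : i <= a -> iter i half (ncons a b) = ncons (a - i) b.
Proof.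
elim: i => [|i IHi] lt; first by rewrite subn0.
rewrite iterS IHi 1?ltnW // /ncons -[a - i]prednK ?subn_gt0 // -subnS expnS.
by rewrite -mulnA mul2n doubleK.
Qed.

(** [nhead] finds the 2-adic valuation by bounded search: the accumulator grows while halving that
    often leaves an even number. As a < 2^a, the number itself bounds the rounds needed. *)
Lemma nhead_ncons a b : nhead (ncons a b) = a.
Proof.
have le : a <= ncons a b.
  by rewrite (leq_trans (ltnW (ltn_expl a (ltnSn 1)))) // leq_pmulr.
rewrite -[RHS](minn_idPr le) /nhead; move: {1 3}(ncons a b) => i.
elim: i => [|i IHi] /=; first by rewrite min0n.
rewrite IHi iter_half_ncons ?geq_minr //.
have [lei|lti] := leqP a i.
  rewrite (minn_idPr (leqW lei)) subnn /ncons mul1n /=.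
  by rewrite odd_double.
rewrite (minn_idPl lti) /ncons -[a - i]prednK ?subn_gt0 // expnS -mulnA mul2n.
by rewrite odd_double.
Qed.

Lemma ntail_ncons a b : ntail (ncons a b) = b.
Proof.
rewrite /ntail nhead_ncons iter_half_ncons // subnn /ncons mul1n.
exact: (half_bit_double b true).
Qed.

Lemma crec_iter n (g : nat -> nat) N F :
  crec 1 (fun v => g (nth 0 v 0)) -> crec n N -> crec n F ->
  crec n (fun v => iter (N v) g (F v)).
Proof.
move=> cg cN cF; suff [c hc] : crec n (fun v => iteri (N v) (fun _ r => g r) (F v)).
  by exists c => v /hc.
apply: (crec_iteri (S := fun _ r _ => g r)) cN cF.
by apply: crec_app1 cg _; apply: crec_proj.
Qed.

Lemma crec_iter_half n N F : crec n N -> crec n F ->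
  crec n (fun v => iter (N v) half (F v)).
Proof. by apply: crec_iter; apply/crec_half/crec_proj. Qed.

Lemma crec_ncons n F G : crec n F -> crec n G -> crec n (fun v => ncons (F v) (G v)).
Proof.
move=> cF cG.
have cdouble m H : crec m H -> crec m (fun v => (H v).*2).
  by move=> cH; have [c hc] := crec_add cH cH; exists c => v /hc; rewrite addnn.
have [c hc] : crec n (fun v => iter (F v) double (G v).*2.+1).
  apply: crec_iter => //; first by apply/cdouble/crec_proj.
  exact/crec_succ/cdouble.
exists c => v /hc; congr (eval _ _ _); rewrite /ncons.
by elim: (F v) => [|m IHm]; rewrite ?mul1n //= IHm expnS -mulnA mul2n.
Qed.

Lemma crec_nhead n F : crec n F -> crec n (fun v => nhead (F v)).
Proof.
apply: crec_app1.
apply: (crec_iteri (S := fun _ r w => ~~ odd (iter r half (nth 0 w 0)) + r)).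
- apply: crec_add; last exact: crec_proj.
  have [c hc] := crec_is0 (crec_odd (crec_iter_half (@crec_proj 3 1 isT)
                   (crec_drop 2 (@crec_proj 1 0 isT)))).
  by exists c => v /hc; case: odd.
- exact: crec_proj.
- exact: crec_const.
Qed.

Lemma crec_ntail n F : crec n F -> crec n (fun v => ntail (F v)).
Proof.
apply: crec_app1; apply/crec_half/crec_iter_half; last exact: crec_proj.
by apply/crec_nhead/crec_proj.
Qed.

Definition computable (A B : countType) (f : A -> B) :=
  exists c, forall a, eval c [:: pickle a] (pickle (f a)).

Section Basics.
Variable E : countType.

Lemma computable_crec (A : countType) (f : E -> A) G :
  crec 1 (fun v => G (nth 0 v 0)) -> (forall e, pickle (f e) = G (pickle e)) ->
  computable f.
Proof. by move=> [c hc] fG; exists c => e; rewrite fG; apply: hc. Qed.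

Lemma computable_comp (A B : countType) (g : A -> B) (f : E -> A) :
  computable g -> computable f -> computable (fun e => g (f e)).
Proof.
move=> [cg hg] [cf hf]; exists (cComp cg [:: cf]) => e.
by apply: ev_comp (evals1 (hf e)) _.
Qed.

Lemma computable_app1 (A B : countType) (g : A -> B) G (f : E -> A) :
  crec 1 (fun v => G (nth 0 v 0)) -> (forall x, pickle (g x) = G (pickle x)) ->
  computable f -> computable (fun e => g (f e)).
Proof.
move=> [cg hg] gG [cf hf]; exists (cComp cg [:: cf]) => e.
by apply: ev_comp (evals1 (hf e)) _; rewrite gG; apply: hg.
Qed.

Lemma computable_app2 (A B C : countType) (g : A -> B -> C) G
    (f1 : E -> A) (f2 : E -> B) :
  crec 2 (fun v => G (nth 0 v 0) (nth 0 v 1)) ->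
  (forall x y, pickle (g x y) = G (pickle x) (pickle y)) ->
  computable f1 -> computable f2 -> computable (fun e => g (f1 e) (f2 e)).
Proof.
move=> [cg hg] gG [c1 h1] [c2 h2]; exists (cComp cg [:: c1; c2]) => e.
apply: (ev_comp (ys := [:: pickle (f1 e); pickle (f2 e)])).
  by do ?constructor.
by rewrite gG; apply: hg.
Qed.

Lemma computable_id : computable (fun e : E => e).
Proof. by apply: (computable_crec (G := id)) => //; apply: crec_proj. Qed.

Lemma computable_const (A : countType) (a : A) : computable (fun _ : E => a).
Proof. by apply: (computable_crec (G := fun=> pickle a)) => //; apply: crec_const. Qed.

Lemma computable_if (A : countType) (b : E -> bool) (f g : E -> A) :
  computable b -> computable f -> computable g ->
  computable (fun e => if b e then f e else g e).
Proof.
move=> [cb hb] [cf hf] [cg hg].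
have [c hc] := crec_ite (@crec_proj 3 0 isT) (@crec_proj 3 2 isT) (@crec_proj 3 1 isT).
exists (cComp c [:: cb; cf; cg]) => e.
apply: (ev_comp (ys := [:: pickle (b e); pickle (f e); pickle (g e)])).
  by do ?constructor.
by have := hc [:: pickle (b e); pickle (f e); pickle (g e)] erefl; case: (b e).
Qed.

Lemma computable_eq (A : countType) (f g : E -> A) :
  computable f -> computable g -> computable (fun e => f e == g e).
Proof.
apply: (computable_app2 (g := fun x y : A => x == y) (G := fun m n => (m == n : nat))).
  by apply: crec_eq; apply: crec_proj.
by move=> x y; rewrite (inj_eq (pcan_inj pickleK)); case: (x == y).
Qed.

Lemma computable_succ f : computable f -> computable (fun e : E => (f e).+1).
Proof. by apply: (computable_app1 (G := S)) => //; apply/crec_succ/crec_proj. Qed.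

Lemma computable_pair (A B : countType) (f : E -> A) (g : E -> B) :
  computable f -> computable g -> computable (fun e => (f e, g e)).
Proof.
(* A pair is pickled as a list of two codes; likewise [Some] as a list of one, and [None] as the
   empty list. *)
apply: (computable_app2 (G := fun m n => ncons m (ncons n 0))) => //.
by apply: crec_ncons; [|apply: crec_ncons; [|apply: crec_const]]; apply: crec_proj.
Qed.

Lemma computable_fst (A B : countType) (f : E -> A * B) :
  computable f -> computable (fun e => (f e).1).
Proof.
apply: (computable_app1 (g := fst) (G := nhead)); first exact/crec_nhead/crec_proj.
by case=> a b; rewrite nhead_ncons.
Qed.

Lemma computable_snd (A B : countType) (f : E -> A * B) :
  computable f -> computable (fun e => (f e).2).
Proof.
apply: (computable_app1 (g := snd) (G := fun m => nhead (ntail m))).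
  exact/crec_nhead/crec_ntail/crec_proj.
by case=> a b; rewrite ntail_ncons nhead_ncons.
Qed.

Lemma computable_Some (A : countType) (f : E -> A) :
  computable f -> computable (fun e => Some (f e)).
Proof.
apply: (computable_app1 (G := fun m => ncons m 0)) => //.
by apply: crec_ncons; [apply: crec_proj|apply: crec_const].
Qed.

Lemma computable_odflt (A : countType) (d : A) (f : E -> option A) :
  computable f -> computable (fun e => odflt d (f e)).
Proof.
apply: (computable_app1 (g := odflt d)
  (G := fun m => if m == 0 then pickle d else nhead m)).
  apply: crec_ite; [apply: crec_proj|apply: crec_const|] => //.
  exact/crec_nhead/crec_proj.
case=> [a|] //=; have -> : pickle (Some a) = ncons (pickle a) 0 by [].
by rewrite nhead_ncons /ncons muln_eq0 expn_eq0.
Qed.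

Lemma computable_cons (A : countType) (f : E -> A) (g : E -> seq A) :
  computable f -> computable g -> computable (fun e => f e :: g e).
Proof.
apply: (computable_app2 (G := ncons)) => //.
by apply: crec_ncons; apply: crec_proj.
Qed.

Lemma computable_behead (A : countType) (f : E -> seq A) :
  computable f -> computable (fun e => behead (f e)).
Proof.
apply: (computable_app1 (g := behead) (G := ntail)); first exact/crec_ntail/crec_proj.
by case=> // x s; rewrite ntail_ncons.
Qed.

Lemma computable_ohead (A : countType) (f : E -> seq A) :
  computable f -> computable (fun e => ohead (f e)).
Proof.
apply: (computable_app1 (g := ohead)
  (G := fun m => if m == 0 then 0 else ncons (nhead m) 0)).
  apply: crec_ite; [apply: crec_proj|apply: crec_const|] => //.
  apply: crec_ncons; last exact: crec_const.
  exact/crec_nhead/crec_proj.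
case=> [|x s] //=; have -> : pickle (x :: s) = ncons (pickle x) (pickle s) by [].
by rewrite nhead_ncons {1}/ncons muln_eq0 expn_eq0.
Qed.

(** A natural number is its own code, so the same program works. *)
Lemma computable_pickle (A : countType) (f : E -> A) :
  computable f -> computable (fun e => pickle (f e)).
Proof. by []. Qed.

Lemma computable_iter (A : countType) (F : E -> A -> A) (n : E -> nat) (a : E -> A) :
  computable (fun p : E * A => F p.1 p.2) -> computable n -> computable a ->
  computable (fun e => iter (n e) (F e) (a e)).
Proof.
move=> [cF hF] [cn hn] [ca ha].
(* [cPrim] supplies index, accumulator and parameter; [cp] drops the index and packs parameter and
   accumulator into the pair that [cF] expects. *)
have [cp hp] : crec 3 (fun v => ncons (nth 0 v 2) (ncons (nth 0 v 1) 0)).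
  by apply: crec_ncons; [|apply: crec_ncons; [|apply: crec_const]]; apply: crec_proj.
exists (cComp (cPrim ca (cComp cF [:: cp])) [:: cn; cProj 0]) => e.
apply: (ev_comp (ys := [:: n e; pickle e])).
  by constructor=> //; apply/evals1/(@ev_proj 0 [:: pickle e]).
elim: (n e) => [|m IHm]; first exact: ev_prim0.
apply: (ev_primS IHm); apply: ev_comp (evals1 _) (hF (e, _)).
exact: hp.
Qed.

End Basics.

Lemma computable_ext (A B : countType) (f g : A -> B) :
  f =1 g -> computable f -> computable g.
Proof. by move=> fg [c hc]; exists c => a; rewrite -fg. Qed.

Ltac computable_step := lazymatch goal with
  | H : computable ?f |- computable ?f => exact H
  | |- computable (fun _ => ?b) => exact: computable_const
  | |- computable (fun e => e) => exact: computable_id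
  | |- computable fst => exact: (computable_fst (computable_id _))
  | |- computable snd => exact: (computable_snd (computable_id _))
  | |- computable (fun e => fst (@?f e)) => apply: computable_fst
  | |- computable (fun e => snd (@?f e)) => apply: computable_snd
  | |- computable (fun e => (@?f e, @?g e)) => apply: computable_pair
  | |- computable (fun e => if _ then _ else _) => apply: computable_if
  | |- computable (fun e => @?f e == @?g e) => apply: computable_eq
  | |- computable (fun e => (@?f e).+1) => apply: computable_succ
  | |- computable (fun e => Some (@?f e)) => apply: computable_Some
  | |- computable (fun e => odflt ?d (@?f e)) => apply: computable_odflt
  | |- computable (fun e => @?f e :: @?g e) => apply: computable_cons
  | |- computable (fun e => behead (@?f e)) => apply: computable_behead
  | |- computable (fun e => ohead (@?f e)) => apply: computable_ohead
  | H : computable ?f |- computable (fun e => ?f (@?g e)) =>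
      apply: (computable_comp H)
  end.
Ltac computable_tac := repeat computable_step.

Lemma computable_app (E A B C : countType) (f : A -> B -> C) (g : E -> A) (h : E -> B) :
  computable (fun p : A * B => f p.1 p.2) -> computable g -> computable h ->
  computable (fun e => f (g e) (h e)).
Proof.
move=> cf cg ch; apply: (computable_comp (f := fun e => (g e, h e)) cf).
exact: computable_pair.
Qed.

(** Iteration on the pair of accumulator and remaining list. The code of the list is at least its
    length and serves as the number of rounds; surplus rounds change nothing. *)
Lemma computable_foldl (E A B : countType) (F : E -> B -> A -> B) (a : E -> B)
    (s : E -> seq A) :
  computable (fun p : E * B * A => F p.1.1 p.1.2 p.2) ->
  computable a -> computable s -> computable (fun e => foldl (F e) (a e) (s e)).
Proof.
move=> cF ca cs.
(* Reading the head needs a default value; if [A] has no element, all lists are empty. *)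
have [[x0]|noA] := classic (inhabited A); last first.
  apply: (computable_ext _ ca) => e.
  by case: (s e) => // x; case: noA.
pose step e (bs : B * seq A) := if bs.2 == [::] then bs
  else (F e bs.1 (odflt x0 (ohead bs.2)), behead bs.2).
have iterE e n b t : size t <= n -> (iter n (step e) (b, t)).1 = foldl (F e) b t.
  elim: n b t => [|n IHn] b [|x t] //= lt; rewrite -iterS iterSr; last exact: IHn.
  by rewrite /step /=; apply: IHn.
have size_pickle (t : seq A) : size t <= pickle t.
  have -> : pickle t = CodeSeq.code (map pickle t) by [].
  elim: t => //= x t IHt; apply: leq_ltn_trans IHt _.
  apply: (@leq_trans (CodeSeq.code (map pickle t)).*2.+1).
    by rewrite ltnS -addnn leq_addr.
  by rewrite leq_pmull ?expn_gt0.
apply: (@computable_ext _ _ (fun e => (iter (pickle (s e)) (step e) (a e, s e)).1)).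
  by move=> e; apply: iterE.
apply: computable_fst; apply: computable_iter; last exact: computable_pair.
  apply: computable_if; computable_tac.
  apply: (computable_comp (f := fun p : E * (B * seq A) =>
    (p.1, p.2.1, odflt x0 (ohead p.2.2))) cF).
  by computable_tac.
exact: computable_pickle.
Qed.

Lemma computable_rev (E A : countType) (s : E -> seq A) :
  computable s -> computable (fun e => rev (s e)).
Proof.
move=> cs; apply: (@computable_ext _ _ (fun e => foldl (fun t x => x :: t) [::] (s e))).
  move=> e; rewrite /rev; elim: (s e) [::] => //= x t IHt r; exact: IHt.
by apply: (computable_foldl (F := fun _ t x => x :: t)); computable_tac.
Qed.

Lemma computable_foldr (E A B : countType) (F : E -> A -> B -> B) (a : E -> B)
    (s : E -> seq A) :
  computable (fun p : E * B * A => F p.1.1 p.2 p.1.2) ->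
  computable a -> computable s -> computable (fun e => foldr (F e) (a e) (s e)).
Proof.
move=> cF ca cs.
apply: (@computable_ext _ _ (fun e => foldl (fun b x => F e x b) (a e) (rev (s e)))).
  by move=> e; rewrite -foldl_rev.
by apply: (computable_foldl (F := fun e b x => F e x b)) => //; apply: computable_rev.
Qed.

Lemma computable_map (E A B : countType) (F : E -> A -> B) (s : E -> seq A) :
  computable (fun p : E * A => F p.1 p.2) -> computable s ->
  computable (fun e => [seq F e x | x <- s e]).
Proof.
move=> cF cs.
apply: (@computable_ext _ _ (fun e => foldr (fun x t => F e x :: t) [::] (s e))).
  by move=> e; elim: (s e) => //= x t ->.
apply: (computable_foldr (F := fun e x t => F e x :: t)); computable_tac.
by apply: (computable_app cF); computable_tac.
Qed.

Lemma computable_cat (E A : countType) (s t : E -> seq A) :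
  computable s -> computable t -> computable (fun e => s e ++ t e).
Proof.
move=> cs ct; apply: (@computable_ext _ _ (fun e => foldr cons (t e) (s e))).
  by move=> e; elim: (s e) => //= x r ->.
by apply: (computable_foldr (F := fun=> cons)); computable_tac.
Qed.

Lemma computable_flatten (E A : countType) (s : E -> seq (seq A)) :
  computable s -> computable (fun e => flatten (s e)).
Proof.
move=> cs; apply: (computable_foldr (F := fun=> cat)); computable_tac.
by apply: computable_cat; computable_tac.
Qed.

Lemma computable_all (E A : countType) (P : E -> A -> bool) (s : E -> seq A) :
  computable (fun p : E * A => P p.1 p.2) -> computable s ->
  computable (fun e => all (P e) (s e)).
Proof.
move=> cP cs.
apply: (@computable_ext _ _
  (fun e => foldr (fun x b => if P e x then b else false) true (s e))).
  by move=> e; elim: (s e) => //= x t ->; case: (P e x).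
apply: (computable_foldr (F := fun e x b => if P e x then b else false));
  computable_tac.
by apply: (computable_app cP); computable_tac.
Qed.

Lemma computable_find (E A : countType) (P : E -> A -> bool) (s : E -> seq A) :
  computable (fun p : E * A => P p.1 p.2) -> computable s ->
  computable (fun e => find (P e) (s e)).
Proof.
move=> cP cs.
apply: (@computable_ext _ _
  (fun e => foldr (fun x n => if P e x then 0 else n.+1) 0 (s e))).
  by move=> e; elim: (s e) => //= x t ->; case: (P e x).
apply: (computable_foldr (F := fun e x n => if P e x then 0 else n.+1));
  computable_tac.
by apply: (computable_app cP); computable_tac.
Qed.

Lemma computable_size (E A : countType) (s : E -> seq A) :
  computable s -> computable (fun e => size (s e)).
Proof.
move=> cs; apply: (@computable_ext _ _ (fun e => foldr (fun _ n => n.+1) 0 (s e))).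
  by move=> e; elim: (s e) => //= x t ->.
by apply: (computable_foldr (F := fun _ _ n => n.+1)); computable_tac.
Qed.

Lemma computable_nth (E A : countType) (x0 : A) (s : E -> seq A) (n : E -> nat) :
  computable s -> computable n -> computable (fun e => nth x0 (s e) (n e)).
Proof.
move=> cs cn.
apply: (@computable_ext _ _ (fun e => odflt x0 (ohead (iter (n e) behead (s e))))).
  move=> e; elim: (n e) (s e) => [|m IHm] [|x t] //; rewrite iterSr IHm //.
  by rewrite /= !nth_nil.
apply: computable_odflt; apply: computable_ohead.
by apply: (computable_iter (F := fun=> behead)); computable_tac.
Qed.

Lemma computable_index (E A : countType) (x : E -> A) (s : E -> seq A) :
  computable x -> computable s -> computable (fun e => index (x e) (s e)).
Proof.
move=> cx cs; apply: (computable_find (P := fun e y => y == x e)) => //.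
by apply: computable_eq; computable_tac.
Qed.

Lemma computable_undup (E A : countType) (s : E -> seq A) :
  computable s -> computable (fun e => undup (s e)).
Proof.
move=> cs.
apply: (@computable_ext _ _ (fun e => foldr (fun x t =>
    if all (fun y => if y == x then false else true) t then x :: t else t) [::] (s e))).
  move=> e; elim: (s e) => //= x t ->; rewrite -[in RHS]mem_undup.
  suff -> : x \in undup t = ~~ all (fun y => if y == x then false else true) (undup t).
    by case: all.
  by elim: (undup t) => //= y r IHr; rewrite inE IHr eq_sym; case: eqP.
apply: (computable_foldr (F := fun _ x t =>
    if all (fun y => if y == x then false else true) t then x :: t else t));
  computable_tac.
apply: (computable_all (P := fun p y => if y == p.2 then false else true)).
  by computable_tac.
by computable_tac.
Qed.

Lemma computable_obind (E A B : countType) (F : E -> A -> option B) (o : E -> option A) :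
  computable (fun p : E * A => F p.1 p.2) -> computable o ->
  computable (fun e => obind (F e) (o e)).
Proof.
move=> cF co; have [[x0]|noA] := classic (inhabited A); last first.
  apply: (@computable_ext _ _ (fun=> None)); last exact: computable_const.
  by move=> e; case: (o e) => // x; case: noA.
apply: (@computable_ext _ _
    (fun e => if o e == None then None else F e (odflt x0 (o e)))).
  by move=> e; case: (o e).
apply: computable_if; computable_tac.
by apply: (computable_app cF); computable_tac.
Qed.

Lemma computable_omap (E A B : countType) (F : E -> A -> B) (o : E -> option A) :
  computable (fun p : E * A => F p.1 p.2) -> computable o ->
  computable (fun e => omap (F e) (o e)).
Proof.
move=> cF co; apply: (computable_obind (F := fun e x => Some (F e x))) => //.
exact: computable_Some.
Qed.

Lemma computable_add (E : countType) (m n : E -> nat) :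
  computable m -> computable n -> computable (fun e => m e + n e).
Proof.
move=> cm cn; apply: (@computable_ext _ _ (fun e => iter (n e) succn (m e))).
  by move=> e; rewrite iter_succn.
by apply: (computable_iter (F := fun=> succn)); computable_tac.
Qed.

Lemma computable_mul (E : countType) (m n : E -> nat) :
  computable m -> computable n -> computable (fun e => m e * n e).
Proof.
move=> cm cn; apply: (@computable_ext _ _ (fun e => iter (n e) (addn (m e)) 0)).
  by move=> e; rewrite iter_addn_0.
apply: (computable_iter (F := fun e => addn (m e))); computable_tac.
by apply: computable_add; computable_tac.
Qed.

Lemma computable_exp (E : countType) (m n : E -> nat) :
  computable m -> computable n -> computable (fun e => m e ^ n e).
Proof.
move=> cm cn; apply: (@computable_ext _ _ (fun e => iter (n e) (muln (m e)) 1)).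
  by move=> e; rewrite iter_muln_1.
apply: (computable_iter (F := fun e => muln (m e))); computable_tac.
by apply: computable_mul; computable_tac.
Qed.

Lemma computable_iota (E : countType) (m n : E -> nat) :
  computable m -> computable n -> computable (fun e => iota (m e) (n e)).
Proof.
move=> cm cn.
apply: (@computable_ext _ _ (fun e => rev (iter (n e)
    (fun s => m e + size s :: s) [::]))).
  move=> e; set s := iter _ _ _.
  suff -> : s = rev (iota (m e) (n e)) by rewrite revK.
  rewrite {}/s; elim: (n e) => //= k ->.
  rewrite size_rev size_iota -rev_rcons -cats1.
  by rewrite -[RHS]/(rev (iota (m e) k.+1)) -addn1 iotaD.
apply: computable_rev.
apply: (computable_iter (F := fun e s => m e + size s :: s)); computable_tac.
by apply: computable_add; [|apply: computable_size]; computable_tac.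
Qed.

(** * Computing the multiplication table *)

Lemma computable_and (E : countType) (b c : E -> bool) :
  computable b -> computable c -> computable (fun e => b e && c e).
Proof.
by move=> cb cc; apply: (computable_if cb cc); apply: computable_const.
Qed.

Lemma computable_neg (E : countType) (b : E -> bool) :
  computable b -> computable (fun e => ~~ b e).
Proof. by move=> cb; apply: (computable_if cb); apply: computable_const. Qed.

Ltac computable_list_step := cbv beta; first [computable_step | lazymatch goal with
  | |- computable (fun e => _ ++ _) => apply: computable_cat
  | |- computable (fun e => map _ _) => apply: computable_map
  | |- computable (fun e => flatten _) => apply: computable_flatten
  | |- computable (fun e => all _ _) => apply: computable_all
  | |- computable (fun e => find _ _) => apply: computable_find
  | |- computable (fun e => index _ _) => apply: computable_index
  | |- computable (fun e => size _) => apply: computable_size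
  | |- computable (fun e => nth _ _ _) => apply: computable_nth
  | |- computable (fun e => undup _) => apply: computable_undup
  | |- computable (fun e => iota _ _) => apply: computable_iota
  | |- computable (fun e => obind _ _) => apply: computable_obind
  | |- computable (fun e => omap _ _) => apply: computable_omap
  | |- computable (fun e => foldl _ _ _) => apply: computable_foldl
  | |- computable (fun e => iter _ _ _) => apply: computable_iter
  | |- computable (fun e => _ && _) => apply: computable_and
  | |- computable (fun e => ~~ _) => apply: computable_neg
  | |- computable (fun e => _ + _) => apply: computable_add
  | |- computable (fun e => _ * _) => apply: computable_mul
  | |- computable (fun e => _ ^ _) => apply: computable_exp
  end].

Lemma computable_strip (E B : countType) (s t : E -> seq B) :
  computable s -> computable t -> computable (fun e => strip (s e) (t e)).
Proof.
move=> cs ct; rewrite /strip /strip_step.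
repeat computable_list_step.
Qed.

Section Quotient.
Variables (A B : countType).

Lemma computable_words (E : countType) (al : E -> seq A) (n : E -> nat) :
  computable al -> computable n -> computable (fun e => words (al e) (n e)).
Proof.
by move=> cal cn; rewrite /words; repeat computable_list_step.
Qed.

Section Parametric.
Variables (D : countType) (f : D -> seq A -> option (seq B)) (W : D -> seq (seq A)).
Hypothesis cf : computable (fun p : D * seq A => f p.1 p.2).
Hypothesis cW : computable W.

Lemma computable_delta (E : countType) (d : E -> D) (x w1 w2 : E -> seq A) :
  computable d -> computable x -> computable w1 -> computable w2 ->
  computable (fun e => delta (f (d e)) (x e) (w1 e) (w2 e)).
Proof.
move=> cd cx c1 c2; rewrite /delta; repeat computable_list_step.
- by apply: computable_strip; repeat computable_list_step.
- by apply: (computable_app cf); repeat computable_list_step.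
- by apply: (computable_app cf); repeat computable_list_step.
Qed.

Lemma computable_sim (E : countType) (d : E -> D) (x y : E -> seq A) :
  computable d -> computable x -> computable y ->
  computable (fun e => sim (f (d e)) (W (d e)) (x e) (y e)).
Proof.
move=> cd cx cy; rewrite /sim; repeat computable_list_step;
  by apply: computable_delta; repeat computable_list_step.
Qed.

Lemma computable_cong (E : countType) (d : E -> D) (u v : E -> seq A) :
  computable d -> computable u -> computable v ->
  computable (fun e => cong (f (d e)) (W (d e)) (u e) (v e)).
Proof.
move=> cd cu cv; rewrite /cong; repeat computable_list_step.
by apply: (computable_sim (d := fun p => d p.1)); repeat computable_list_step.
Qed.

Lemma computable_rep (E : countType) (d : E -> D) (u : E -> seq A) :
  computable d -> computable u ->
  computable (fun e => rep (f (d e)) (W (d e)) (u e)).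
Proof.
move=> cd cu; rewrite /rep; repeat computable_list_step.
by apply: (computable_cong (d := fun p => d p.1)); repeat computable_list_step.
Qed.

Lemma computable_reps (E : countType) (d : E -> D) :
  computable d -> computable (fun e => reps (f (d e)) (W (d e))).
Proof.
move=> cd; apply: computable_undup.
apply: (computable_map (F := fun e => rep (f (d e)) (W (d e)))).
  by apply: (computable_rep (d := fun p => d p.1)); repeat computable_list_step.
exact: (computable_comp cW).
Qed.

Lemma computable_idx (E : countType) (d : E -> D) (u : E -> seq A) :
  computable d -> computable u ->
  computable (fun e => idx (f (d e)) (W (d e)) (u e)).
Proof.
move=> cd cu; apply: computable_index; first exact: computable_rep.
exact: computable_reps.
Qed.

Lemma computable_mtable : computable (fun d => mtable (f d) (W d)).
Proof.
have creps : computable (fun d => reps (f d) (W d)).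
  exact/(computable_reps (d := id))/computable_id.
apply: computable_pair; first exact: computable_size.
apply: computable_pair.
  by apply: (computable_idx (d := id)); repeat computable_list_step.
pose row d u := [seq idx (f d) (W d) (u ++ v) | v <- reps (f d) (W d)].
apply: (computable_map (F := row)) => //.
apply: (computable_map (F := fun p v => idx (f p.1) (W p.1) (p.2 ++ v))).
  by apply: (computable_idx (d := fun p => p.1.1)); repeat computable_list_step.
exact/(computable_reps (d := fst))/computable_fst/computable_id.
Qed.

End Parametric.
End Quotient.

(** * Invariance of the table under injective renaming of letters *)

Section Renaming.
Variables (A A' : eqType) (h : A -> A').
Hypothesis h_inj : injective h.
Local Notation hs := (map h).

Lemma strip_map s t : strip (hs s) (hs t) = (hs (strip s t).1, hs (strip s t).2).
Proof.
elim: s t => [|x s IHs] [|y t] //.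
- by rewrite !strip_ohead.
have [<-|neq] := eqVneq x y; first by rewrite /= !strip_cons IHs.
have neq1 : ohead (x :: s) != ohead (y :: t) by apply: contra neq => /eqP[->].
have neq2 : ohead (hs (x :: s)) != ohead (hs (y :: t)).
  by apply: contra neq => /eqP[/h_inj->].
by rewrite (strip_ohead neq1) (strip_ohead neq2).
Qed.

Lemma words_map al n : words (hs al) n = map hs (words al n).
Proof.
elim: n => //= n IHn; congr (_ :: _).
rewrite map_flatten -!map_comp; congr flatten; apply: eq_map => a /=.
by rewrite -/(words _ _) IHn -!map_comp; apply: eq_map.
Qed.

Variables (f : seq A -> option (seq A)) (f' : seq A' -> option (seq A')).
Variable W : seq (seq A).
Hypothesis ff' : forall u, f' (hs u) = omap hs (f u).
Local Notation W' := (map hs W).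

Lemma delta_map x w1 w2 : delta f' (hs x) (hs w1) (hs w2) =
  omap (fun p => (hs p.1, hs p.2)) (delta f x w1 w2).
Proof.
rewrite /delta -!map_cat !ff'.
case: (f (x ++ w1)) => [s|] //=; case: (f (x ++ w2)) => [t|] //=.
by rewrite strip_map.
Qed.

Lemma sim_map x y : sim f' W' (hs x) (hs y) = sim f W x y.
Proof.
rewrite /sim all_map; apply: eq_all => w1 /=.
rewrite all_map; apply: eq_all => w2 /=; rewrite !delta_map.
apply: inj_eq => -[p|] [q|] // [e1 e2]; congr Some.
by apply/eqP; rewrite -pair_eqE /pair_eq /= (inj_map h_inj e1) (inj_map h_inj e2) !eqxx.
Qed.

Lemma cong_map u v : cong f' W' (hs u) (hs v) = cong f W u v.
Proof.
rewrite /cong all_map; apply: eq_all => x /=.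
by rewrite -!map_cat sim_map.
Qed.

Lemma rep_map u : rep f' W' (hs u) = hs (rep f W u).
Proof.
rewrite /rep find_map (eq_find (a2 := cong f W u)); last first.
  by move=> v /=; rewrite cong_map.
have [lt|ge] := ltnP (find (cong f W u) W) (size W); first by rewrite (nth_map [::]).
by rewrite !nth_default ?size_map.
Qed.

Lemma reps_map : reps f' W' = map hs (reps f W).
Proof.
rewrite /reps -(undup_map_inj (inj_map h_inj)) -!map_comp; congr undup.
by apply: eq_map => u /=; rewrite rep_map.
Qed.

Lemma idx_map u : idx f' W' (hs u) = idx f W u.
Proof. by rewrite /idx reps_map rep_map index_map //; apply: inj_map. Qed.

(** The table records only indices, so one program over natural number letters serves every alphabet
    ['I_k]. *)
Lemma mtable_map : mtable f' W' = mtable f W.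
Proof.
rewrite /mtable reps_map size_map -(idx_map [::]) -map_comp.
congr (_, (_, _)); apply: eq_map => u /=.
by rewrite -map_comp; apply: eq_map => v /=; rewrite -map_cat idx_map.
Qed.

End Renaming.

(** * The program on encoded transducers and its correctness *)

Definition raw_dft : countType :=
  (nat * (nat * (nat * (seq (seq (option (nat * seq nat))) *
    (seq nat * seq (option (seq nat)))))))%type.

(** Free of dependent types, and such that [dft_encode T] is [pickle (raw T)] by definition. *)
Definition raw k (T : dft k) : raw_dft :=
  (k, (d_n T, (val (d_init T),
    ([seq [seq omap (fun qw => (val qw.1, map val qw.2)) (d_delta T q a)
              | a <- enum 'I_k] | q <- enum 'I_(d_n T)],
     (map val (d_iout T),
      [seq omap (map val) (d_term T q) | q <- enum 'I_(d_n T)]))))).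

(** The state travels with the output so far, so that a left fold suffices. Entries outside the
    table read as undefined transitions. *)
Definition raw_run (D : raw_dft) (st : nat * seq nat) (u : seq nat) :=
  foldl (fun st a => obind (fun qw => omap (fun rw => (rw.1, qw.2 ++ rw.2))
    (nth None (nth [::] D.2.2.2.1 qw.1) a)) st) (Some st) u.

Definition raw_fun (D : raw_dft) (u : seq nat) :=
  obind (fun qw => omap (fun t => qw.2 ++ t) (nth None D.2.2.2.2.2 qw.1))
    (raw_run D (D.2.2.1, D.2.2.2.2.1) u).

(** The list [W] of test words read off the raw data: [D.1] is the alphabet size, [D.2.1] the number
    of states, and the length is [bound]. *)
Definition raw_words (D : raw_dft) :=
  words (iota 0 D.1) (D.2.1.+1 ^ D.2.1.+1 + D.2.1.+1 * D.2.1.+1).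

Lemma computable_program : computable (fun D => mtable (raw_fun D) (raw_words D)).
Proof.
apply: computable_mtable.
  rewrite /raw_fun /raw_run; repeat computable_list_step.
rewrite /raw_words; apply: computable_words; repeat computable_list_step.
Qed.

Section RawCorrect.
Variables (k : nat) (T : dft k).
Local Notation vs := (map val).

Lemma raw_delta (q : 'I_(d_n T)) (a : 'I_k) :
  nth None (nth [::] (raw T).2.2.2.1 q) a =
  omap (fun qw => (val qw.1, vs qw.2)) (d_delta T q a).
Proof.
rewrite (nth_map q) ?size_enum_ord // nth_ord_enum.
by rewrite (nth_map a) ?size_enum_ord // nth_ord_enum.
Qed.

Lemma raw_run_map (q : 'I_(d_n T)) w (u : seq 'I_k) :
  raw_run (raw T) (val q, w) (vs u) =
  omap (fun ro => (val ro.1, w ++ vs ro.2)) (drun T q u).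
Proof.
elim: u q w => [|a u IHu] q w; first by rewrite /raw_run /= cats0.
rewrite /raw_run [vs _]/= [foldl _ _ _]/= raw_delta [drun _ _ _]/=.
case: (d_delta T q a) => [[r o]|] /=; last by elim: (vs u).
have := IHu r (w ++ vs o); rewrite /raw_run => ->.
by case: (drun T r u) => [[r' o']|] //=; rewrite map_cat catA.
Qed.

Lemma raw_fun_map u : raw_fun (raw T) (vs u) = omap vs (dfun T u).
Proof.
rewrite /raw_fun /dfun raw_run_map.
case: (drun T _ u) => [[q o]|] //=.
rewrite (nth_map q) ?size_enum_ord // nth_ord_enum.
by case: (d_term T q) => [t|] //=; rewrite !map_cat catA.
Qed.

Lemma raw_words_map : raw_words (raw T) = map vs (words (enum 'I_k) (bound T)).
Proof. by rewrite -words_map val_enum_ord. Qed.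

Lemma program_correct :
  mtable (raw_fun (raw T)) (raw_words (raw T)) =
  mtable (dfun T) (words (enum 'I_k) (bound T)).
Proof.
by rewrite raw_words_map; apply: mtable_map; [apply: val_inj|apply: raw_fun_map].
Qed.

End RawCorrect.

Theorem mainTheorem6 (V : fmon -> Prop) (HV : monoid_variety V)
  (Hdec : exists c : code, decides_on fm_encode V c) :
  exists c : code, forall (k : nat) (T : dft k),
    (V_definable V T -> eval c [:: dft_encode T] 1) /\
    (~ V_definable V T -> eval c [:: dft_encode T] 0).
Proof.
have [c hc] := Hdec; have [cp hp] := computable_program.
exists (cComp c [:: cp]) => k T.
set M := qmon (@congP k T) (@W_full k T).
have VM : V_definable V T <-> V M by apply: V_definable_qmon.
(* The table computed over natural numbers is, by renaming, the encoding of the quotient monoid. *)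
have ev : evals [:: cp] [:: dft_encode T] [:: fm_encode M].
  by apply: evals1; rewrite fm_encode_qmon -program_correct; apply: (hp (raw T)).
have [yes no] := hc M; rewrite VM.
by split=> h; apply: (ev_comp ev); [apply: yes|apply: no].
Qed.
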